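(* For each finite subset $[m,n]=\{m,m+1,\dots,n\}\subset\mathbb{Z}$, with $m<n$ integers, and each strictly increasing map $l:\mathbb{Z}\to\mathbb{Z}$ (i.e. defining a subsequence of $\mathbb{Z}$), there exists $r=r_{[m,n],l}\in\mathbb{I}_\mathbb{Z}$ such that $l([m,n])=r([m,n])$.
   Context: For $h\in\mathbb{Z}$ the right hand side partial shift $\theta_h:\mathbb{Z}\to\mathbb{Z}$ is $\theta_h(k)=k$ if $k<h$ and $\theta_h(k)=k+1$ if $k\ge h$; the left hand side partial shift $\psi_h:\mathbb{Z}\to\mathbb{Z}$ is $\psi_h(k)=k$ if $k>h$ and $\psi_h(k)=k-1$ if $k\le h$. $\mathbb{I}_\mathbb{Z}$ is the monoid, under composition, generated by all $\theta_h$ and $\psi_h$, $h\in\mathbb{Z}$. *)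

(* Defs.v *)
From mathcomp Require Import all_boot all_order all_algebra.
From mathcomp Require Import boolp classical_sets.

Set Implicit Arguments.
Unset Strict Implicit.
Unset Printing Implicit Defensive.

Import Order.TTheory GRing.Theory Num.Theory.

Local Open Scope classical_set_scope.
Local Open Scope ring_scope.

Definition theta (h : int) : int -> int := fun k => if k < h then k else k + 1.

Definition psi (h : int) : int -> int := fun k => if k > h then k else k - 1.

(* Submonoids of the monoid of all self-maps of T under composition. *)
Definition is_submonoid (T : Type) (S : set (T -> T)) : Prop :=
  S id /\ forall f g : T -> T, S f -> S g -> S (f \o g).

Definition I_Z : set (int -> int) :=
  smallest (@is_submonoid int) (range theta `|` range psi).

(* Main.v *)
Require Import Defs.
From mathcomp Require Import all_boot all_order all_algebra.
From mathcomp Require Import boolp classical_sets set_interval.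
From mathcomp Require Import zify.

Set Implicit Arguments.
Unset Strict Implicit.
Unset Printing Implicit Defensive.

Import Order.TTheory GRing.Theory Num.Theory.

Local Open Scope classical_set_scope.
Local Open Scope ring_scope.

(** A power of [theta h] opens a gap of any prescribed size between the images
    of [h - 1] and [h] while it fixes everything to the left of [h]. So it is
    enough to start from a map in [I_Z] that takes [[m, n]] to consecutive
    integers beginning at [l m] ([translation_in_I_Z]): each of its gaps is at
    most the corresponding gap of the strictly increasing map [l], and the gaps
    can be widened one at a time from left to right ([agree_on_prefix]). Once
    the values at [m, ..., a] are those of [l], a power of [theta (l a + 1)]
    corrects the value at [a + 1], keeps the earlier ones, and moves the values
    further right as a block. The resulting map agrees with [l] at each point of
    [[m, n]], which is more than equality of the two images. *)

Lemma I_Z_submonoid : is_submonoid I_Z.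
Proof.
split=> [S [[S1 _] _] //|f g fI gI S HS].
by have [[_ SM] _] := HS; apply: SM; [apply: fI | apply: gI].
Qed.

Lemma I_Z_comp f g : I_Z f -> I_Z g -> I_Z (f \o g).
Proof. by have [_] := I_Z_submonoid; apply. Qed.

Lemma I_Z_theta h : I_Z (theta h).
Proof. by move=> S [_]; apply; left; exists h. Qed.

Lemma I_Z_psi h : I_Z (psi h).
Proof. by move=> S [_]; apply; right; exists h. Qed.

Lemma I_Z_iter f c : I_Z f -> I_Z (iter c f).
Proof.
move=> fI; elim: c => [|c IHc]; first by have [] := I_Z_submonoid.
exact: (I_Z_comp fI IHc).
Qed.

Lemma iter_theta c h k :
  iter c (theta h) k = if k < h then k else k + c%:Z.
Proof.
elim: c => [|c IHc]; first by rewrite /= addr0 if_same.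
by rewrite iterS IHc /theta; case: (ltP k h) => kh; case: ifP; lia.
Qed.

Lemma iter_psi c h k :
  iter c (psi h) k = if k > h then k else k - c%:Z.
Proof.
elim: c => [|c IHc]; first by rewrite /= subr0 if_same.
by rewrite iterS IHc /psi; case: (ltP h k) => kh; case: ifP; lia.
Qed.

(** Although [I_Z] contains no nontrivial translation of the whole line, a power
    of a single generator imitates one on a bounded interval: the threshold goes
    to the left end for [theta] and to the right end for [psi], so that every
    point of the interval moves. *)
Lemma translation_in_I_Z (m n t : int) :
  exists2 r, I_Z r & forall k, m <= k <= n -> r k = k + t.
Proof.
have [t0|t0] := leP 0 t.
- exists (iter `|t|%N (theta m)); first exact: (I_Z_iter _ (I_Z_theta _)).
  by move=> k kmn; rewrite iter_theta; case: ifP; lia.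
- exists (iter `|t|%N (psi n)); first exact: (I_Z_iter _ (I_Z_psi _)).
  by move=> k kmn; rewrite iter_psi; case: ifP; lia.
Qed.

(** Prescribing consecutive values beyond the prefix is what keeps the
    induction going: they never exceed those of [l], so only upward corrections,
    which [theta] can make without disturbing the prefix, are ever needed. *)
Lemma agree_on_prefix (m n : int) (l : int -> int) (j : nat) :
    {homo l : x y / x < y} ->
  exists2 r, I_Z r & forall k, m <= k <= n ->
    r k = if k <= m + j%:Z then l k else l (m + j%:Z) + (k - (m + j%:Z)).
Proof.
move=> hl; elim: j => [|j [r rI rE]].
  have [r rI rE] := translation_in_I_Z m n (l m - m).
  exists r => // k kmn; rewrite rE // addr0.
  case: ifP => km; last by lia.
  have -> : k = m by lia.
  by lia.
set a := m + j%:Z in rE *.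
have -> : m + j.+1%:Z = a + 1 by lia.
have la : l a < l (a + 1) by apply: hl; lia.
have lle x y : x <= y -> l x <= l y.
  by rewrite le_eqVlt => /predU1P[->//|/hl/ltW].
exists (iter `|(l (a + 1) - l a - 1)%R|%N (theta (l a + 1)) \o r).
  exact: (I_Z_comp (I_Z_iter _ (I_Z_theta _)) rI).
move=> k kmn; rewrite /= iter_theta rE //.
have [ka|ka] := leP k a.
  have := lle _ _ ka; rewrite (_ : (k <= a + 1) = true); last by lia.
  by case: ifP; lia.
have [ka1|ka1] := leP k (a + 1); last by case: ifP; lia.
have -> : k = a + 1 by lia.
by case: ifP; lia.
Qed.

Theorem proposition2p1 (m n : int) (l : int -> int) (hmn : m < n)
    (hl : {homo l : x y / x < y}) :
  exists r : int -> int, I_Z r /\ l @` `[m, n] = r @` `[m, n].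
Proof.
have [r rI rE] := agree_on_prefix m n `|(n - m)%R|%N hl.
exists r; split=> //; apply: eq_imagel => k /=; rewrite in_itv /= => kmn.
by rewrite rE // ifT //; lia.
Qed.
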